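(* Let $n$ be an odd positive integer. For $k=1,2,\ldots$ define the polynomial $$a_k(x)=\sum_{m=0}^{k} J(k-m,n)\,x^m,$$ where $J(a,n)$ denotes the Jacobi symbol, and let $$H_n(x)=\det\big[a_{i+j-1}(x)\big]_{1\le i,j\le n}.$$ Then $H_n(x)$ is identically zero unless $n=p$ is a prime. For $n=p$ an odd prime, $$H_p(x)=(-1)^{\frac{p-1}{2}}\,p^{\frac{p-3}{2}}\sum_{k=0}^{p-1} b_k x^k,\qquad\text{where } b_k=\sum_{i=1}^{p-k}\left(\frac{i}{p}\right)$$ and $\left(\frac{i}{p}\right)$ is the Legendre symbol. Furthermore, $H_p(x)$ is divisible in $\mathbb{Z}[x]$ by $x^2$ if $p\equiv 3\pmod 4$, and by $x^2(x^2-1)$ if $p\equiv 1\pmod 4$.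
   Context: For an odd integer $m$ with prime factorization $m=p_1^{e_1}\cdots p_k^{e_k}$, the Jacobi symbol is $J(a,m)=\prod_{i}\left(\frac{a}{p_i}\right)^{e_i}$, where for a prime $p$ the Legendre symbol $\left(\frac{a}{p}\right)$ is $0$ if $p\mid a$, $1$ if $a$ is a nonzero quadratic residue mod $p$, and $-1$ if $a$ is a quadratic nonresidue mod $p$. (For $n=1$ the empty product convention gives $J(a,1)=1$.)
   Formalization: The claim that H_n(x) is identically zero for non-prime n is stated only for n > 1, since for n = 1 the convention J(a,1) = 1 gives H_1(x) = 1 + x, which is not zero. *)

(* Defs.v *)
From HB Require Import structures.
From mathcomp Require Import all_boot all_order all_algebra.
Set Implicit Arguments.
Unset Strict Implicit.
Unset Printing Implicit Defensive.

Import Order.TTheory GRing.Theory Num.Theory.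
Local Open Scope ring_scope.

(* Since 'I_p is a complete residue system mod p, the boolean quantifier says
   that a is congruent to the square of some integer. *)
Definition legendre (a : int) (p : nat) : int :=
  if (p %| a)%Z then 0
  else if [exists b : 'I_p, (b%:Z ^+ 2 == a %[mod p])%Z] then 1
  else -1.

(* Meaningful for odd m; jacobi a 1 = 1 as an empty product. *)
Definition jacobi (a : int) (m : nat) : int :=
  \prod_(q <- primes m) legendre a q ^+ logn q m.

Definition jacobi_poly (n k : nat) : {poly int} :=
  \sum_(0 <= m < k.+1) (jacobi (k%:Z - m%:Z) n)%:P * 'X^m.

(* 'I_n starts at 0, so the matrix entry (i, j) below is entry (i+1, j+1) in
   1-based numbering. *)
Definition jacobi_hankel (n : nat) : {poly int} :=
  \det (\matrix_(i < n, j < n) jacobi_poly n (i.+1 + j.+1 - 1)).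

Definition legendre_psum (p k : nat) : int :=
  \sum_(1 <= i < (p - k).+1) legendre i%:Z p.

(* Main.v *)
(* Subtracting x times each row from the next one turns the Hankel matrix into
   a matrix whose first row is (a_1, ..., a_n) and whose other rows are rows of
   C = (J(i + j - 1, n)). For n composite, pick a prime q | n and r = n / q.
   If q | r then J(., n) has period r and two rows are equal; otherwise the rows
   at distance r from each other sum to 0, as the Legendre symbol mod q sums
   to 0 along an arithmetic progression of length q.
   For n = p prime, C C = p I - 11^T and C 1 = 0, so all the cofactors of C have
   a common value c and H_p = c (a_1 + ... + a_p). To find c with its sign, note
   that A = C / sqrt p + 11^T / p is an involution of trace 1, so that
   det A = (-1)^((p-1)/2), while det (C + 11^T / sqrt p) = c p sqrt p.
   If p = 1 mod 4 then (-1/p) = 1 gives b_(p+1-k) = - b_k for 1 <= k <= p; as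
   p + 1 is even and b_0 = b_p = 0, the sum of b_k x^k vanishes at 1 and -1. *)
Require Import Defs.
From HB Require Import structures.
From mathcomp Require Import all_boot all_order all_algebra.
From mathcomp Require Import ring zify cyclic algC finfield.
Set Implicit Arguments.
Unset Strict Implicit.
Unset Printing Implicit Defensive.

Import Order.TTheory GRing.Theory Num.Theory.
Local Open Scope ring_scope.

(** * Rank-one updates and involutions *)

(** Sylvester's identity: the block matrix with rows [(1, A)] and [(B, 1)] is factored in two ways,
    clearing [B] by row or by column operations. *)
Lemma det_1subM (R : comPzRingType) (m n : nat) (A : 'M[R]_(m, n))
    (B : 'M[R]_(n, m)) :
  \det (1%:M - A *m B) = \det (1%:M - B *m A).
Proof.
have E1 : block_mx 1%:M A B 1%:M
    = block_mx 1%:M 0 B 1%:M *m block_mx 1%:M A 0 (1%:M - B *m A).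
  by rewrite mulmx_block !mul1mx !mul0mx !mulmx1 !addr0 addrC subrK.
have E2 : block_mx 1%:M A B 1%:M
    = block_mx (1%:M - A *m B) A 0 1%:M *m block_mx 1%:M 0 B 1%:M.
  by rewrite mulmx_block !mul1mx !mul0mx !mulmx1 !mulmx0 !add0r subrK.
have := congr1 determinant E1; rewrite {1}E2 !det_mulmx !det_ublock !det_lblock.
by rewrite !det1 !mulr1 !mul1r.
Qed.

(** In a rank factorization [E = U V], idempotence forces [V U = 1], of size the rank. The trace
    and, by Sylvester's identity, the determinant are computed on that smaller matrix. *)
Lemma mxtrace_det_idem (F : fieldType) (n : nat) (E : 'M[F]_n) :
  E *m E = E -> \tr E = (\rank E)%:R /\ \det (1%:M - E *+ 2) = (-1) ^+ \rank E.
Proof.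
move=> EE.
have BC : row_base E *m col_base E = 1%:M.
  apply: (row_full_inj (col_base_full E)).
  apply: (row_free_inj (row_base_free E)).
  by rewrite /= mulmx1 mulmxA -mulmxA !mulmx_base.
split.
  by rewrite -{1}(mulmx_base E) mxtrace_mulC BC mxtrace1.
rewrite -[in LHS](mulmx_base E) -scaler_nat scalemxAl det_1subM -scalemxAr BC.
by rewrite scaler_nat mulr2n opprD addNKr -scaleN1r detZ det1 mulr1.
Qed.

(* [(1 - A) / 2] is a projection, so its rank is its trace, here [k]. *)
Lemma det_involution (F : numFieldType) (n k : nat) (A : 'M[F]_n) :
  A *m A = 1%:M -> \tr A + k.*2%:R = n%:R -> \det A = (-1) ^+ k.
Proof.
move=> AA trA; pose E := 2^-1 *: (1%:M - A).
have E2 : E *+ 2 = 1%:M - A.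
  by rewrite -scaler_nat scalerA mulfV ?scale1r // pnatr_eq0.
have EE : E *m E = E.
  rewrite {2}/E -scalemxAr mulmxBr mulmx1 {2}/E -scalemxAl mulmxBl mul1mx AA.
  rewrite -[A - 1%:M]opprB scalerN opprK -/E -mulr2n -scaler_nat scalerA.
  by rewrite mulVf ?scale1r // pnatr_eq0.
have [trE detE] := mxtrace_det_idem EE.
suff -> : k = \rank E by rewrite -detE E2 subKr.
apply/eqP; rewrite -(eqr_nat F) -trE mxtraceZ raddfB /= mxtrace1 -trA addrC
  addKr.
by rewrite -mul2n natrM mulKf // pnatr_eq0.
Qed.

Lemma det_1addM_rank1 (R : comPzRingType) (n : nat) (u : 'cV[R]_n)
    (v : 'rV[R]_n) :
  \det (1%:M + u *m v) = 1 + (v *m u) 0 0.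
Proof.
rewrite -[u *m v]opprK -mulNmx det_1subM mulmxN opprK.
by rewrite (mx11_scalar (1%:M + _)) det_scalar1 !mxE.
Qed.

Lemma eq_cofactor_row (R : pzRingType) (n : nat) (M N : 'M[R]_n) (i : 'I_n) :
  (forall k j, k != i -> M k j = N k j) ->
  forall j, cofactor M i j = cofactor N i j.
Proof.
move=> MN j; rewrite /cofactor; congr (_ * \det _); apply/matrixP => k l.
by rewrite !mxE MN // eq_sym neq_lift.
Qed.

(** * The common cofactor *)

Section CofactorOfConferenceCore.

Variables (n k : nat) (C : 'M[int]_n).
Hypothesis Dn : n = k.*2.+1.
Hypothesis k_gt0 : (0 < k)%N.
(** Together with [sumC] and [symC]: bordering [C] by ones, with corner 0, gives a symmetric matrix
    of square [n], of which [C] is the core. *)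
Hypothesis CC : C *m C = n%:R%:M - const_mx 1.
Hypothesis sumC : forall i, \sum_j C i j = 0.
Hypothesis symC : forall i j, C i j = C j i.
Hypothesis trC : \tr C = 0.

Let n_gt0 : (0 < n)%N. Proof. by rewrite Dn. Qed.

Lemma det_core : \det C = 0.
Proof.
apply/eqP/det0P; exists (const_mx 1).
  apply/eqP => /rowP/(_ (Ordinal n_gt0)); rewrite !mxE => /eqP.
  by rewrite oner_eq0.
apply/rowP => j; rewrite !mxE -[RHS](sumC j); apply: eq_bigr => i _.
by rewrite mxE mul1r symC.
Qed.

(** As [\det C = 0], multiplying [CC] by [\adj C] gives [n \adj C = J \adj C] with [J] all ones, so
    an entry of the adjugate depends only on its column, that is, on a row of cofactors. *)
Lemma cofactor_core_const i j j' : cofactor C i j = cofactor C i j'.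
Proof.
have E : n%:R *: \adj C = const_mx 1 *m \adj C.
  apply/eqP; rewrite -mul_scalar_mx -subr_eq0 -mulmxBl -CC -mulmxA mul_mx_adj.
  by rewrite det_core raddf0 mulmx0.
have H l : n%:R * cofactor C i l = \sum_m cofactor C i m.
  have /matrixP/(_ l i) := E; rewrite !mxE => ->.
  by apply: eq_bigr => m _; rewrite !mxE mul1r.
apply: (@mulfI _ (n%:R : int)); first by rewrite pnatr_eq0 -lt0n.
by rewrite !H.
Qed.

Lemma cofactor_core i : cofactor C i i = (-1) ^+ k * n%:R ^+ k.-1.
Proof.
pose c := cofactor C i i; rewrite -/c.
(* A square root of [n] is needed, so the computation takes place in [algC] and is pulled back to
   the integers at the end. *)
pose r : algC := sqrtC n%:R.
have r2 : r * r = n%:R by rewrite -expr2 sqrtCK.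
have n0 : n%:R != 0 :> algC by rewrite pnatr_eq0 -lt0n.
have r0 : r != 0 by rewrite sqrtC_eq0.
pose C' : 'M[algC]_n := map_mx intr C.
pose J : 'M[algC]_n := const_mx 1.
pose B : 'M[algC]_n := C' + r^-1 *: J.
have CC' : C' *m C' = n%:R%:M - J.
  rewrite -map_mxM CC map_mxB map_scalar_mx rmorph_nat; congr (_ - _).
  by apply/matrixP => a b; rewrite !mxE.
have sumC' a : \sum_b C' a b = 0.
  rewrite -[RHS](rmorph0 intr) -(sumC a) rmorph_sum /=.
  by apply: eq_bigr => b _; rewrite mxE.
have CJ : C' *m J = 0.
  apply/matrixP => a b; rewrite !mxE -[RHS](sumC' a); apply: eq_bigr => d _.
  by rewrite [J _ _]mxE mulr1.
have JC : J *m C' = 0.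
  apply/matrixP => a b; rewrite !mxE -[RHS](sumC' b); apply: eq_bigr => d _.
  by rewrite [J _ _]mxE mul1r !mxE symC.
have JJ : J *m J = n%:R *: J.
  apply/matrixP => a b; rewrite !mxE; under eq_bigr do rewrite !mxE mulr1.
  by rewrite sumr_const card_ord mulr1.
have rVn : r^-1 * n%:R = r by rewrite -r2 mulKf.
have BB : B *m B = n%:R%:M.
  rewrite mulmxDl !mulmxDr -!scalemxAr -!scalemxAl CC' CJ JC JJ !scaler0.
  rewrite addr0 add0r !scalerA -mulrA rVn mulVf // scale1r.
  by rewrite subrK.
have trB : \tr B = r.
  rewrite raddfD /= linearZ /= (_ : \tr C' = 0) ?add0r; last first.
    rewrite -[RHS](rmorph0 intr) -trC rmorph_sum /=.
    by apply: eq_bigr => a _; rewrite mxE.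
  by rewrite -[RHS]rVn /mxtrace; under eq_bigr do rewrite mxE;
    rewrite sumr_const card_ord.
have detB : \det B = r ^+ n * (-1) ^+ k.
  rewrite -[B in LHS](scalerKV r0) detZ; congr (_ * _).
  apply: det_involution.
    by rewrite -scalemxAl -scalemxAr scalerA BB scale_scalar_mx -invfM r2 mulVf.
  by rewrite linearZ /= trB mulVf // Dn -add1n natrD.
pose d : 'cV[algC]_n := delta_mx i 0.
(* [U1] adds all other rows to row [i], which becomes constantly [n / r = r] as the columns of [C']
   sum to 0. [U2] then subtracts [1 / n] times that row, the constant [r^-1], from the other rows,
   leaving those of [C']. *)
pose U1 := 1%:M + d *m (const_mx 1 - d^T).
pose U2 := 1%:M + (- n%:R^-1 *: (const_mx 1 - d)) *m d^T.
have detU1 : \det U1 = 1.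
  rewrite det_1addM_rank1 mulmxBl trmx_delta mul_delta_mx !mxE (bigD1 i) //=
    !mxE !eqxx.
  rewrite big1 ?addr0 ?mulr1 ?subrr ?addr0 // => a ai.
  by rewrite !mxE (negPf ai) mulr0.
have detU2 : \det U2 = 1.
  rewrite det_1addM_rank1 -scalemxAr mulmxBr trmx_delta mul_delta_mx !mxE
    (bigD1 i) //= !mxE !eqxx.
  rewrite big1 ?addr0 ?mulr1 ?subrr ?mulr0 ?addr0 // => a ai.
  by rewrite !mxE (negPf ai) mul0r.
have U1B : U1 *m B = B + d *m (const_mx r - row i B).
  rewrite mulmxDl mul1mx -mulmxA mulmxBl; congr (_ + _ *m (_ - _)); last first.
    by rewrite trmx_delta -rowE.
  apply/rowP => b; rewrite !mxE.
  under eq_bigr do rewrite !mxE mulr1 mul1r symC.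
  rewrite big_split sumr_const card_ord /=.
  rewrite -mulr_natr rVn -[RHS]add0r; congr (_ + _).
  by rewrite -[RHS](sumC' b); apply: eq_bigr => a _; rewrite mxE.
have colE (u : 'cV[algC]_n) (v : 'rV[algC]_n) a b : (u *m v) a b = u a 0 * v 0
  b.
  by rewrite mxE big_ord1.
have XE a b : (U1 *m B) a b = if a == i then r else B a b.
  rewrite U1B mxE colE !mxE eqxx andbT.
  by case: eqP => [->|_]; rewrite ?mul0r ?addr0 // mul1r addrC subrK.
pose M := U2 *m (U1 *m B).
have ME a b : M a b = if a == i then r else C' a b.
  rewrite /M mulmxDl mul1mx -mulmxA trmx_delta -rowE mxE colE.
  rewrite [row i _ 0 b]mxE !XE !mxE !eqxx andbT.
  case: eqP => _ /=; first by rewrite subrr mulr0 mul0r addr0.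
  by rewrite subr0 !mulr1 mulNr -[in X in - X]r2 invfM mulfVK ?addrK.
(* Row [i] of [M] is constantly [r], and all [n] cofactors along it equal [c]. *)
have detM : \det M = c%:~R * n%:R * r.
  rewrite (expand_det_row _ i) (eq_bigr (fun=> c%:~R * r)).
    by rewrite sumr_const card_ord -[LHS]mulr_natr mulrAC.
  move=> b _; rewrite ME eqxx mulrC; congr (_ * _).
  rewrite /c (cofactor_core_const i i b) -cofactor_map_mx;
    apply: eq_cofactor_row.
  by move=> a b' ai; rewrite ME (negPf ai).
have : c%:~R * n%:R * r = (n%:R ^+ k * (-1) ^+ k) * r.
  have -> : n%:R ^+ k * (-1) ^+ k * r = r ^+ n * (-1) ^+ k.
    by rewrite [in RHS]Dn exprS -mul2n exprM expr2 r2 mulrAC [r * _]mulrC.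
  by rewrite -detM /M !det_mulmx detU1 detU2 !mul1r.
(* Cancelling one factor [n] from [n ^ k] requires [k > 0] and produces the exponent [k.-1]. *)
move/(mulIf r0); rewrite mulrC -[in X in _ = X -> _](prednK k_gt0) exprS -mulrA.
move/(mulfI n0) => Dc; apply: (@intr_inj algC).
by rewrite Dc rmorphM /= !rmorphXn /= rmorph_nat rmorphN1 (prednK k_gt0) mulrC.
Qed.

(** The cofactors along row [i] involve only rows of [C]. The ring is arbitrary so that row [i] can
    hold polynomials. *)
Lemma det_core_row (R : comPzRingType) (i : 'I_n) (M : 'M[R]_n) :
  (forall a b, a != i -> M a b = (C a b)%:~R) ->
  \det M = (-1) ^+ k * n%:R ^+ k.-1 * \sum_j M i j.
Proof.
move=> MC; rewrite (expand_det_row _ i) mulr_sumr; apply: eq_bigr => b _.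
rewrite mulrC; congr (_ * _).
rewrite (@eq_cofactor_row _ _ M (map_mx intr C) i); last first.
  by move=> a b' ai; rewrite mxE MC.
rewrite cofactor_map_mx (cofactor_core_const i b i) cofactor_core.
by rewrite rmorphM /= !rmorphXn /= rmorph_nat rmorphN1.
Qed.

End CofactorOfConferenceCore.

(** * The quadratic character of a finite field *)

Definition quadchar (F : finFieldType) (x : F) : int :=
  if x == 0 then 0 else if [exists y : F, y ^+ 2 == x] then 1 else -1.

Lemma finField_gt1 (F : finFieldType) : (1 < #|F|)%N.
Proof. exact: finNzRing_gt1. Qed.

(** The nonzero elements are [#|F|.-1] distinct roots of unity of that order, so one of them is
    primitive. *)
Lemma finField_prim_root (F : finFieldType) :
  exists g : F, #|F|.-1.-primitive_root g.
Proof.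
have F1 := finField_gt1 F.
pose rs := [seq x <- enum F | x != 0].
have szrs : size rs = #|F|.-1.
  by rewrite /rs enumT -(cardC1 (0 : F)) cardE /enum_mem; congr size;
    apply: eq_filter.
have /hasP[g _ prg] : has (#|F|.-1).-primitive_root rs.
  apply: has_prim_root; rewrite ?szrs //; first by lia.
    apply/allP => x; rewrite mem_filter => /andP[x0 _].
    apply/unity_rootP; apply: (mulfI x0).
    by rewrite -exprS prednK ?mulr1 ?expf_card //; lia.
  by rewrite filter_uniq // enum_uniq.
by exists g.
Qed.

Lemma prim_root_gen (F : finFieldType) (g x : F) :
  #|F|.-1.-primitive_root g -> x != 0 -> exists k : nat, x = g ^+ k.
Proof.
move=> prg x0; have F1 := finField_gt1 F.
have : x ^+ #|F|.-1 = 1.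
  by apply: (mulfI x0); rewrite -exprS prednK ?mulr1 ?expf_card //; lia.
by case/(prim_rootP prg) => i ->; exists i.
Qed.

Lemma prim_root_neq0 (F : finFieldType) (g : F) k :
  #|F|.-1.-primitive_root g -> g ^+ k != 0.
Proof.
move=> prg; rewrite expf_neq0 //; apply/eqP => g0.
move: (prim_expr_order prg); rewrite g0 expr0n.
by have := prim_order_gt0 prg; case: eqP => [->//|_ _ /eqP];
  rewrite eq_sym oner_eq0.
Qed.

Section QuadraticCharacter.

Variable F : finFieldType.
Hypothesis F_odd : odd #|F|.

(** As [#|F|.-1] is even, a power of [g] determines the parity of its exponent; the nonzero squares
    are the even powers. *)
Lemma quadchar_prim_root (g : F) k :
  #|F|.-1.-primitive_root g -> quadchar (g ^+ k) = (-1) ^+ k.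
Proof.
move=> prg; rewrite /quadchar (negPf (prim_root_neq0 _ prg)).
have evenP i j : g ^+ i = g ^+ j -> odd i = odd j.
  have F1 := finField_gt1 F.
  move/eqP; rewrite (eq_prim_root_expr prg) => /eqP/(congr1 odd).
  have H m : odd (m %% #|F|.-1) = odd m.
    rewrite [in RHS](divn_eq m #|F|.-1) oddD oddM.
    have -> : odd #|F|.-1 = false by lia.
    by rewrite andbF.
  by rewrite !H.
rewrite -signr_odd; case: ifPn => [/existsP[y /eqP yk]|/existsPn nsq].
  have [y0|y0] := eqVneq y 0.
    by move: (prim_root_neq0 k prg); rewrite -yk y0 expr0n eqxx.
  have [l Dy] := prim_root_gen prg y0; move: yk.
  by rewrite Dy -exprM => /evenP <-; rewrite oddM andbF.
move: (nsq (g ^+ k./2)); rewrite -exprM muln2.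
by case odd_k: (odd k) => //; rewrite even_halfK ?odd_k // eqxx.
Qed.

Lemma quadchar0 : quadchar (0 : F) = 0.
Proof. by rewrite /quadchar eqxx. Qed.

Lemma quadchar1 : quadchar (1 : F) = 1.
Proof.
by have [g prg] := finField_prim_root F; rewrite -(expr0 g) quadchar_prim_root.
Qed.

Lemma quadcharM (x y : F) : quadchar (x * y) = quadchar x * quadchar y.
Proof.
have [->|x0] := eqVneq x 0; first by rewrite !(mul0r, quadchar0).
have [->|y0] := eqVneq y 0; first by rewrite !(mulr0, quadchar0).
have [g prg] := finField_prim_root F.
have [k ->] := prim_root_gen prg x0; have [l ->] := prim_root_gen prg y0.
by rewrite -exprD !quadchar_prim_root // exprD.
Qed.

Lemma quadchar_sqr (x : F) : x != 0 -> quadchar x * quadchar x = 1.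
Proof.
move=> x0; have [g prg] := finField_prim_root F.
have [k ->] := prim_root_gen prg x0.
by rewrite quadchar_prim_root // -expr2 sqrr_sign.
Qed.

(** Multiplication by a generator [g] permutes [F] and changes the sign of every term. *)
Lemma sum_quadchar : \sum_(x : F) quadchar x = 0.
Proof.
have [g prg] := finField_prim_root F.
have g0 : g != 0 by rewrite -[g]expr1 prim_root_neq0.
have : \sum_(x : F) quadchar x = \sum_(x : F) - quadchar x.
  rewrite [LHS](reindex_inj (mulfI g0)) /=; apply: eq_bigr => x _.
  by rewrite quadcharM -{1}[g]expr1 quadchar_prim_root // expr1 mulN1r.
by move/eqP; rewrite sumrN -addr_eq0 -mulr2n mulrn_eq0 => /eqP.
Qed.

(** For [a = b] each nonzero argument contributes 1. Otherwise put [c = a - b]: after a shift,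
    dividing [c + x] and [x] by [x] leaves the character at [c / x + 1], and [x -> c / x] permutes
    the nonzero elements. What remains is the full character sum without its value at 1. *)
Lemma sum_quadchar_shift (a b : F) :
  \sum_x quadchar (a + x) * quadchar (b + x) = #|F|%:Z * (a == b)%:Z - 1.
Proof.
have [->|ab] := eqVneq a b.
  rewrite mulr1 (reindex_inj (addrI (- b))) /=.
  under eq_bigr do rewrite addrA subrr add0r.
  rewrite (bigD1 0) //= quadchar0 mulr0 add0r.
  under eq_bigr do rewrite quadchar_sqr //.
  rewrite sumr_const (cardC1 (0 : F)) -[#|F| in RHS]prednK; last first.
    by have := finField_gt1 F; lia.
  by rewrite -[#|F|.-1.+1]addn1 natz PoszD addrK.
rewrite mulr0 add0r (reindex_inj (addrI (- b))) /=.
have c0 : a - b != 0 by rewrite subr_eq0.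
pose c := a - b; rewrite -/c in c0.
under eq_bigr do rewrite addrA -/c addrA subrr add0r.
rewrite (bigD1 0) //= quadchar0 mulr0 add0r.
transitivity (\sum_(x | x != 0 :> F) quadchar (c / x + 1)).
  apply: eq_bigr => x x0; rewrite -quadcharM -[RHS]mul1r -(quadchar_sqr x0).
  by rewrite -!quadcharM; congr quadchar; field.
(* With the convention [0^-1 = 0] this holds on all of [F], with 0 fixed. *)
have divK : involutive (fun x => c / x).
  by move=> x; rewrite /= invf_div mulrCA divff ?mulr1.
rewrite (reindex_inj (inv_inj divK)) /=.
under eq_bigr do rewrite divK.
have H x : (c / x != 0) = (x != 0) by rewrite mulf_eq0 invr_eq0 (negPf c0).
rewrite (eq_bigl _ _ H) {H}.
have := sum_quadchar; rewrite (reindex_inj (addIr 1)) (bigD1 0) //= add0r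
  quadchar1.
by move/eqP; rewrite addrC addr_eq0 => /eqP.
Qed.

(** If [-1 = g ^ k], then [#|F| - 1] divides [2 k]; as 4 divides [#|F| - 1], [k] is even. *)
Lemma quadcharN1 : #|F| = 1 %[mod 4] -> quadchar (-1 : F) = 1.
Proof.
move=> F4; have [g prg] := finField_prim_root F; have F1 := finField_gt1 F.
have N10 : -1 != 0 :> F by rewrite oppr_eq0 oner_eq0.
have [k Dk] := prim_root_gen prg N10.
rewrite Dk quadchar_prim_root // -signr_odd.
have : (#|F|.-1 %| k * 2)%N.
  by rewrite (prim_order_dvd prg) exprM -Dk sqrrN expr1n.
case/dvdnP => l kl; suff -> : odd k = false by [].
have [m Fm] : exists m, #|F|.-1 = (4 * m)%N by exists (#|F| %/ 4)%N; lia.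
by have -> : k = (2 * (l * m))%N by [rewrite Fm in kl; lia]; rewrite oddM.
Qed.

Lemma quadcharN (x : F) : #|F| = 1 %[mod 4] -> quadchar (- x) = quadchar x.
Proof. by move=> F4; rewrite -mulN1r quadcharM quadcharN1 // mul1r. Qed.

End QuadraticCharacter.

(** * Jacobi symbols and composite moduli *)

Lemma natr_Fp_inj (p : nat) :
  prime p -> injective (fun i : 'I_p => i%:R : 'F_p).
Proof.
move=> pr i j /(congr1 val) /=.
by rewrite !val_Fp_nat // !modn_small // => /val_inj.
Qed.

Lemma sum_Fp (V : nmodType) (p : nat) (f : 'F_p -> V) :
  prime p -> \sum_(i < p) f i%:R = \sum_x f x.
Proof.
move=> pr; have natr_bij : bijective (fun i : 'I_p => i%:R : 'F_p).
  by apply: inj_card_bij (natr_Fp_inj pr) _; rewrite card_Fp // card_ord.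
by rewrite [RHS](reindex _ (onW_bij _ natr_bij)).
Qed.

Lemma legendre_Fp (p : nat) (a : int) :
  prime p -> legendre a p = quadchar (a%:~R : 'F_p).
Proof.
move=> pr; have dvdE (d : int) : (p %| d)%Z = (d%:~R == 0 :> 'F_p).
  by rewrite (dvdz_pcharf (pchar_Fp pr)).
rewrite /legendre /quadchar dvdE; case: ifP => // _; congr (if _ then _ else _).
apply/existsP/existsP => [[b]|[y]].
  rewrite eqz_mod_dvd dvdE rmorphB /= subr_eq0 rmorphXn /= => ab.
  by exists b%:R.
move=> /eqP ya; have y_lt : (val y < p)%N by apply: leq_trans (ltn_ord y) _;
  rewrite Fp_cast.
exists (Ordinal y_lt); rewrite eqz_mod_dvd dvdE rmorphB rmorphXn /= subr_eq0.
by rewrite -ya [_%:~R]natr_Zp.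
Qed.

Lemma eq_legendre (p : nat) (a b : int) :
  (p %| a - b)%Z -> legendre a p = legendre b p.
Proof.
rewrite -eqz_mod_dvd => /eqP ab; rewrite /legendre; congr (if _ then _ else _).
  by apply/dvdz_mod0P/dvdz_mod0P; rewrite ab.
by congr (if _ then _ else _); apply: eq_existsb => c; rewrite ab.
Qed.

(** Congruence modulo each prime divisor of [n] suffices, rather than modulo [n]; this gives the
    period [n / q] when [q] divides [n / q]. *)
Lemma eq_jacobi (n : nat) (a b : int) :
  (forall q, q \in primes n -> (q %| a - b)%Z) -> jacobi a n = jacobi b n.
Proof.
by move=> ab; apply: eq_big_seq => q /ab/eq_legendre ->.
Qed.

Lemma jacobi_prime (p : nat) (a : int) : prime p -> jacobi a p = legendre a p.
Proof.
by move=> pr; rewrite /jacobi primes_prime // big_seq1 logn_prime // eqxx.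
Qed.

Lemma jacobi_primeM (q r : nat) (a : int) :
  prime q -> (0 < r)%N -> ~~ (q %| r)%N ->
  jacobi a (q * r) = legendre a q * jacobi a r.
Proof.
move=> pr_q r_gt0 q_r; have q_gt0 := prime_gt0 pr_q.
have q_notin : q \notin primes r by rewrite mem_primes pr_q r_gt0.
rewrite /jacobi (perm_big (q :: primes r)); last first.
  apply: uniq_perm; rewrite /= ?q_notin ?primes_uniq // => l.
  by rewrite primesM // primes_prime // !inE.
have q0 : logn q r = 0%N by apply/eqP; rewrite -leqn0 leqNgt logn_gt0.
rewrite big_cons lognM // logn_prime // eqxx q0; congr (_ * _).
apply: eq_big_seq => l l_r; rewrite lognM // logn_prime //.
by case: eqP => // lq; rewrite -lq l_r in q_notin.
Qed.

(** As [r] is invertible modulo [q], the progression meets every residue class once. *)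
Lemma sum_legendre_progression (q r : nat) (b : int) :
  prime q -> odd q -> ~~ (q %| r)%N ->
  \sum_(k < q) legendre (b + (k * r)%N%:Z) q = 0.
Proof.
move=> pr q_odd q_r.
have r0 : r%:R != 0 :> 'F_q by rewrite -(dvdn_pcharf (pchar_Fp pr)).
pose f (x : 'F_q) := quadchar (b%:~R + x * r%:R).
transitivity (\sum_(k < q) f k%:R).
  apply: eq_bigr => k _; rewrite legendre_Fp // /f.
  by rewrite rmorphD /= -natrM.
have f_inj : injective (fun x : 'F_q => b%:~R + x * r%:R).
  by move=> x y /addrI /(mulIf r0).
rewrite sum_Fp // -[RHS](@sum_quadchar 'F_q) ?card_Fp //.
by rewrite [RHS](reindex_inj f_inj).
Qed.

(** * Row reduction of the Hankel matrix and vanishing for composite moduli *)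

Lemma jacobi_polyS (n k : nat) :
  jacobi_poly n k.+1 = (jacobi k.+1%:Z n)%:P + 'X * jacobi_poly n k.
Proof.
rewrite /jacobi_poly big_nat_recl // subr0 mulr1 big_distrr /=; congr (_ + _).
apply: eq_bigr => m _; rewrite exprS mulrCA; congr (_ * (_%:P * _)).
by congr jacobi; lia.
Qed.

Lemma jacobi_hankelE (n : nat) :
  jacobi_hankel n =
  \det (\matrix_(i < n, j < n)
    if i == 0%N :> nat then jacobi_poly n j.+1 else (jacobi (i + j).+1%:Z
      n)%:P).
Proof.
(* Left multiplication by [T] subtracts ['X] times each row from the next; by [jacobi_polyS], only
   constants remain below row 0. *)
pose T : 'M[{poly int}]_n :=
  \matrix_(i, l) ((i == l)%:R - 'X * (i == l.+1 :> nat)%:R).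
have detT : \det T = 1.
  rewrite det_trig; last first.
    apply/is_trig_mxP => i j ij; rewrite mxE -val_eqE /=.
    by rewrite !ltn_eqF ?mulr0 ?subr0 // ltnW.
  by rewrite big1 // => i _; rewrite mxE eqxx ltn_eqF // mulr0 subr0.
rewrite /jacobi_hankel -[LHS]mul1r -detT -det_mulmx; congr (\det _).
apply/matrixP => i j; rewrite !mxE.
under eq_bigr do rewrite !mxE mulrBl addSn addnS subn1 /=.
rewrite sumrB (bigD1 i) //= eqxx mul1r big1 ?addr0; last first.
  by move=> l li; rewrite eq_sym (negPf li) mul0r.
case: ifPn => [/eqP i0|i0].
  by rewrite i0 big1 ?subr0 // => l _; rewrite mulr0 mul0r.
have i1_lt : (i.-1 < n)%N by apply: leq_ltn_trans (ltn_ord i); exact: leq_pred.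
rewrite (bigD1 (Ordinal i1_lt)) //= big1 ?addr0; last first.
  move=> l; rewrite -val_eqE /= => li; rewrite (_ : (_ == _) = false) ?mulr0
    ?mul0r //.
  by lia.
have -> : (i == i.-1.+1 :> nat) by lia.
have -> : (i.-1 + j).+1 = (i + j)%N by lia.
by rewrite jacobi_polyS mulr1 addrK.
Qed.

Lemma jacobi_hankel_composite (n : nat) :
  odd n -> (1 < n)%N -> ~~ prime n -> jacobi_hankel n = 0.
Proof.
move=> n_odd n1 n_np; pose q := pdiv n; pose r := (n %/ q)%N.
have pr_q : prime q := pdiv_prime n1.
have q1 := prime_gt1 pr_q.
have Dn : n = (q * r)%N by rewrite mulnC divnK // pdiv_dvd.
have r1 : (1 < r)%N.
  case: r Dn => [|[|//]] Dn; first by rewrite Dn muln0 in n1.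
  by rewrite Dn muln1 pr_q in n_np.
have q_odd : odd q by move: n_odd; rewrite Dn oddM => /andP[].
clearbody q r.
rewrite jacobi_hankelE; have [q_r|q_r] := boolP (q %| r)%N.
  (* Rows 1 and [1 + r] are compared, since row 0 holds the polynomials. They agree because every
     prime divisor of [n] divides [r]. *)
  have lt2n : (1 + r < n)%N by rewrite Dn; nia.
  apply: (@determinant_alternate _ _ _ (Ordinal n1) (Ordinal lt2n)).
    by rewrite -val_eqE /=; lia.
  move=> j; rewrite !mxE /=; congr _%:P; apply: eq_jacobi => l l_n.
have -> : (1 + j).+1%:Z - (1 + r + j).+1%:Z = - r%:Z by lia.
  rewrite dvdzE abszN /=.
  move: l_n; rewrite Dn primesM ?(prime_gt0 pr_q) ?(ltnW r1) //.
  rewrite primes_prime // inE => /orP[/eqP-> //|].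
  by rewrite mem_primes => /and3P[].
have lt_row (k : 'I_q) : (1 + k * r < n)%N by rewrite Dn; have := ltn_ord k;
  nia.
apply/eqP/det0P.
(* This vector selects the rows [1 + k r]; its entry at 1 comes from [k = 0] alone, hence is
   nonzero. *)
exists (\sum_(k < q) delta_mx 0 (Ordinal (lt_row k))).
  apply/eqP => /rowP/(_ (Ordinal n1)).
  rewrite summxE mxE (bigD1 (Ordinal (ltnW q1))) //= big1.
    by rewrite !mxE -val_eqE /= addr0 => /eqP; rewrite oner_eq0.
  move=> k; rewrite -val_eqE /= => k0; rewrite !mxE /=.
  by case: eqP => // /(congr1 val) /=; nia.
apply/rowP => j; rewrite mulmx_suml summxE mxE.
under eq_bigr do rewrite -rowE !mxE /=.
rewrite -(rmorph_sum polyC) /=.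
(* The symbol modulo [r] does not change with [k], so only the Legendre symbol modulo [q] is
   summed. *)
transitivity (polyC (\sum_(k < q)
    (legendre ((1 + j).+1%:Z + (k * r)%N%:Z) q * jacobi (1 + j).+1%:Z r))).
  congr polyC; apply: eq_bigr => k _; rewrite [X in jacobi _ X]Dn jacobi_primeM
    //; last by lia.
  congr (_ * _); first by congr legendre; lia.
  apply: eq_jacobi => l; rewrite mem_primes => /and3P[_ _ l_r].
  have -> : (1 + k * r + j).+1%:Z - (1 + j).+1%:Z = (k * r)%N%:Z by lia.
  by rewrite dvdzE dvdn_mull.
by rewrite -mulr_suml sum_legendre_progression ?mul0r.
Qed.

(** * Prime moduli *)

Lemma legendre0 (p : nat) : legendre 0 p = 0.
Proof. by rewrite /legendre dvdz0. Qed.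

Lemma sum_legendre (p : nat) :
  prime p -> odd p -> \sum_(1 <= i < p) legendre i%:Z p = 0.
Proof.
move=> pr p_odd; rewrite -[RHS](@sum_quadchar 'F_p) ?card_Fp //.
rewrite -(sum_Fp _ pr) -(big_mkord xpredT (fun i => quadchar (i%:R : 'F_p))).
rewrite [RHS]big_ltn ?prime_gt0 // quadchar0 add0r.
by apply: eq_bigr => i _; rewrite legendre_Fp.
Qed.

Lemma coef_jacobi_poly (n k m : nat) :
  (jacobi_poly n k)`_m = if (m <= k)%N then jacobi (k%:Z - m%:Z) n else 0.
Proof.
rewrite /jacobi_poly big_mkord; under eq_bigr do rewrite mul_polyC.
by rewrite -(poly_def _ (fun m => jacobi (k%:Z - m%:Z) n)) coef_poly ltnS.
Qed.

Definition psum_poly (p : nat) : {poly int} :=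
  \sum_(0 <= k < p) (legendre_psum p k)%:P * 'X^k.

Lemma coef_psum_poly (p k : nat) :
  (psum_poly p)`_k = if (k < p)%N then legendre_psum p k else 0.
Proof.
rewrite /psum_poly big_mkord; under eq_bigr do rewrite mul_polyC.
by rewrite -poly_def coef_poly.
Qed.

(** The coefficient of ['X^m] collects the symbols of [j + 1 - m] for [m <= j + 1 <= p]; a term with
    [j + 1 = m] is the symbol of 0 and drops out. *)
Lemma sum_jacobi_poly (p : nat) :
  prime p -> \sum_(j < p) jacobi_poly p j.+1 = psum_poly p.
Proof.
move=> pr; apply/polyP => m; rewrite coef_sum coef_psum_poly.
rewrite -(big_mkord xpredT (fun j => (jacobi_poly p j.+1)`_m)).
under eq_bigr do rewrite coef_jacobi_poly jacobi_prime //.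
case: ltnP => [m_lt|m_ge]; last first.
  rewrite big_nat big1 // => j /andP[_ j_lt]; case: leqP => // mj.
  have -> : j.+1%:Z - m%:Z = 0 by lia.
  exact: legendre0.
rewrite (big_cat_nat (n := m)) //=; last exact: ltnW.
rewrite big_nat big1 ?add0r => [|j /andP[_ j_lt]]; last first.
  case: leqP => // mj; have -> : j.+1%:Z - m%:Z = 0 by lia.
  exact: legendre0.
rewrite /legendre_psum -{1}[m]add0n big_addn [RHS]big_add1 /=.
apply: eq_bigr => j _; have -> : (m <= (j + m).+1)%N by lia.
by have -> : (j + m).+1%:Z - m%:Z = j.+1%:Z by lia.
Qed.

Section PrimeModulus.

Variable p : nat.
Hypothesis pr : prime p.
Hypothesis p_odd : odd p.

Let cardF : #|'F_p| = p. Proof. exact: card_Fp. Qed.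
Let F_odd : odd #|'F_p|. Proof. by rewrite cardF. Qed.
Let p_gt2 : (2 < p)%N. Proof. by have := prime_gt1 pr; lia. Qed.

(** With indices from 0, [i + j + 1] is the [i + j - 1] of 1-based numbering. Depending on [i + j]
    only, [C] is symmetric whatever the value of [p] modulo 4. *)
Let C : 'M[int]_p := \matrix_(i, j) quadchar ((i + j).+1%:R : 'F_p).

Lemma jacobi_hankel_prime :
  jacobi_hankel p =
  (-1) ^+ ((p - 1) %/ 2) * p%:R ^+ ((p - 3) %/ 2) * psum_poly p.
Proof.
have CE i j : C i j = quadchar (i.+1%:R + j%:R : 'F_p) by rewrite mxE -natrD
  addSn.
have symC i j : C i j = C j i by rewrite !mxE addnC.
have CC : C *m C = p%:R%:M - const_mx 1.
  apply/matrixP => i j; rewrite !mxE.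
  pose f (x : 'F_p) := quadchar (i.+1%:R + x) * quadchar (j.+1%:R + x).
  transitivity (\sum_(l < p) f l%:R).
    by apply: eq_bigr => l _; rewrite (symC l) !CE.
  rewrite (sum_Fp f pr) sum_quadchar_shift // cardF; congr (_ - _).
  rewrite -!natr1 (inj_eq (addIr _)) (inj_eq (natr_Fp_inj pr)) -natz.
  by case: eqP; rewrite ?mulr1 ?mulr0.
have sumC i : \sum_j C i j = 0.
  rewrite -[RHS](@sum_quadchar 'F_p) // [RHS](reindex_inj (addrI i.+1%:R)).
  rewrite -(sum_Fp (fun x => quadchar (i.+1%:R + x)) pr).
  by apply: eq_bigr => j _; rewrite CE.
have two0 : 2%:R != 0 :> 'F_p.
  rewrite -(dvdn_pcharf (pchar_Fp pr)) gtnNdvd //.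
have trC : \tr C = 0.
  (* The diagonal entries are the characters of [1 + 2 j], which runs over all of ['F_p] as 2 is
     invertible. *)
  have aff_inj : injective (fun x : 'F_p => 1 + 2%:R * x).
    by move=> x y /addrI /(mulfI two0).
  rewrite -[RHS](@sum_quadchar 'F_p) // [RHS](reindex_inj aff_inj).
  rewrite -(sum_Fp (fun x => quadchar (1 + 2%:R * x)) pr).
  by apply: eq_bigr => j _; rewrite mxE addnn -mul2n -natrM nat1r.
have Dp : p = (p./2).*2.+1 by lia.
have i0_lt := prime_gt0 pr; pose i0 := Ordinal i0_lt.
rewrite jacobi_hankelE (@det_core_row _ p./2 C _ _ CC sumC symC trC _ i0) //;
  last 2 first.
- by lia.
- move=> i j; rewrite -val_eqE /= => i_neq0; rewrite !mxE (negPf i_neq0).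
  by rewrite jacobi_prime // legendre_Fp // -[X in X%:P]intz rmorph_int.
congr (_ ^+ _ * _ ^+ _ * _); [by lia | by lia |].
by rewrite -sum_jacobi_poly //; apply: eq_bigr => j _; rewrite mxE.
Qed.

Lemma legendre_psum0 : legendre_psum p 0 = 0.
Proof.
rewrite /legendre_psum subn0 big_nat_recr ?prime_gt0 //= sum_legendre // add0r.
by rewrite legendre_Fp // [_%:~R]pchar_Fp_0 // quadchar0.
Qed.

(** The coefficients at 0 and 1 both vanish, being complete character sums. *)
Lemma psum_poly_dvdX2 : exists g, psum_poly p = 'X^2 * g.
Proof.
have b1 : legendre_psum p 1 = 0.
  by rewrite /legendre_psum subn1 prednK ?prime_gt0 // sum_legendre.
exists (\sum_(2 <= k < p) (legendre_psum p k)%:P * 'X^(k - 2)).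
rewrite /psum_poly big_ltn ?prime_gt0 // big_ltn ?prime_gt1 // legendre_psum0
  b1 !mul0r !add0r.
rewrite big_distrr /= big_nat [RHS]big_nat; apply: eq_bigr => k /andP[k2 _].
by rewrite mulrCA -exprD subnKC.
Qed.

(** * Antisymmetry of the partial sums for primes congruent to 1 modulo 4 *)

Hypothesis p_mod4 : p = 1 %[mod 4].

(** Reflecting [i] to [p - i] turns the sum at [k] into one over [k <= i < p], while the sum at
    [p + 1 - k] is over [1 <= i < k]; together they form a complete sum. *)
Lemma legendre_psum_anti (k : nat) :
  (0 < k <= p)%N -> legendre_psum p (p.+1 - k) = - legendre_psum p k.
Proof.
case/andP => k_gt0 kp.
have symL (i : nat) : (i <= p)%N -> legendre (p - i)%N%:Z p = legendre i%:Z p.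
  move=> ip; rewrite !legendre_Fp // -(@quadcharN 'F_p) ?cardF //;
    congr quadchar.
  by rewrite -[LHS]/(- (p - i)%N%:R) natrB // pchar_Fp_0 // sub0r opprK.
apply/eqP; rewrite -addr_eq0 -(sum_legendre pr p_odd).
rewrite [X in _ == X](big_cat_nat (n := k)) //=.
have -> : legendre_psum p k = \sum_(k <= i < p) legendre i%:Z p.
  rewrite /legendre_psum big_nat_rev /= -{3}(subnKC k_gt0) big_addn.
  have -> : (p - (k - 1) = (p - k).+1)%N by lia.
  rewrite big_nat [RHS]big_nat; apply: eq_bigr => i i_bnd.
  rewrite -symL; last by lia.
  by congr (legendre (Posz _)); lia.
by rewrite /legendre_psum; have -> : (p - (p.+1 - k)).+1 = k by lia.
Qed.

Lemma horner_psum_poly_eq0 (e : int) : e * e = 1 -> (psum_poly p).[e] = 0.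
Proof.
move=> ee; have bp : legendre_psum p p = 0 by rewrite /legendre_psum subnn
  big_geq.
(* Trading the zero term at 0 for the zero term at [p] makes the range stable under
   [k -> p + 1 - k]. *)
have -> : (psum_poly p).[e] = \sum_(1 <= k < p.+1) legendre_psum p k * e ^+ k.
  rewrite big_nat_recr ?prime_gt0 //= bp mul0r addr0 /psum_poly.
  rewrite [\sum_(0 <= _ < _) _]big_ltn ?prime_gt0 // legendre_psum0 mul0r add0r
    horner_sum.
  by apply: eq_bigr => k _; rewrite hornerM hornerXn hornerC.
set S := \sum_(_ <= _ < _) _.
suff : S = - S by lia.
rewrite {1}/S big_nat_rev /= -sumrN big_nat [RHS]big_nat;
  apply: eq_bigr => k /andP[k1 kp].
have -> : (1 + p.+1 - k.+1 = p.+1 - k)%N by lia.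
rewrite legendre_psum_anti ?k1 // mulNr; congr (- (_ * _)).
(* The factor [(e * e) ^+ k = 1] turns the power into [e ^+ p.+1 * e ^+ k], and [p.+1] is even. *)
have -> : e ^+ (p.+1 - k) = e ^+ (p.+1 - k) * (e * e) ^+ k by rewrite ee expr1n
  mulr1.
rewrite exprMn mulrA -exprD subnK; last by lia.
have -> : p.+1 = (2 * (p.+1)./2)%N by lia.
by rewrite exprM expr2 ee expr1n mul1r.
Qed.

Lemma psum_poly_dvd : exists g, psum_poly p = 'X^2 * ('X^2 - 1) * g.
Proof.
have [g Dg] := psum_poly_dvdX2.
have rg (e : int) : e * e = 1 -> g.[e] = 0.
  move=> ee; have := horner_psum_poly_eq0 ee.
  by rewrite Dg hornerM hornerXn expr2 ee mul1r.
(* The linear factors are monic, so the division stays over the integers; at -1 the factor ['X - 1]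
   takes the nonzero value -2. *)
have /factor_theorem[h Dh] : root g 1 by apply/eqP; rewrite rg.
have /factor_theorem[l Dl] : root h (-1).
  have := rg (-1) erefl; rewrite Dh hornerM hornerXsubC => /eqP.
  by rewrite mulf_eq0 orbF.
by exists l; rewrite Dg Dh Dl polyC1 polyCN; ring.
Qed.

End PrimeModulus.

Theorem theorem1 (n : nat) (n_odd : odd n) :
  [/\ (1 < n)%N -> ~~ prime n -> jacobi_hankel n = 0,
      prime n ->
        jacobi_hankel n =
          (-1) ^+ ((n - 1) %/ 2) * n%:R ^+ ((n - 3) %/ 2) *
          \sum_(0 <= k < n) (legendre_psum n k)%:P * 'X^k,
      prime n -> n = 3 %[mod 4] ->
        exists q : {poly int}, jacobi_hankel n = 'X^2 * q
    & prime n -> n = 1 %[mod 4] ->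
        exists q : {poly int}, jacobi_hankel n = 'X^2 * ('X^2 - 1) * q].
Proof.
split=> [|pr|pr _|pr n4]; first exact: jacobi_hankel_composite.
- exact: jacobi_hankel_prime.
- have [g Dg] := psum_poly_dvdX2 pr n_odd.
  by rewrite jacobi_hankel_prime // Dg mulrCA; eexists.
- have [g Dg] := psum_poly_dvd pr n_odd n4.
  by rewrite jacobi_hankel_prime // Dg mulrCA; eexists.
Qed.
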